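(* Let $\alpha=\alpha_0\alpha_1\alpha_2\ldots$ be an aperiodic sequence over a finite alphabet such that $\#\mathcal{A}_\alpha=\ell\ge 3$ and such that every letter of $\mathcal{A}_\alpha$ appears infinitely often in $\alpha$. If $p^*_\alpha(k)=2k+\ell-2$ for all $k\in\mathbb{N}$, then there exists an integer $m>1$ such that, among the $m$ residues $\alpha^{(i)}=\alpha_i\alpha_{i+m}\alpha_{i+2m}\ldots$, $0\le i\le m-1$, exactly one is aperiodic, this aperiodic residue is a pattern Sturmian sequence over two letters, and all other residues are constant.
   Context: $\mathbb{N}=\{1,2,\ldots\}$, $\mathbb{N}_0=\{0,1,2,\ldots\}$. A sequence over a finite alphabet $\mathcal{A}$ is $\alpha=\alpha_0\alpha_1\ldots\in\mathcal{A}^{\mathbb{N}_0}$; $\mathcal{A}_\alpha$ is the set of letters that occur in $\alpha$. The shift is $\sigma(\alpha_0\alpha_1\alpha_2\ldots)=\alpha_1\alpha_2\ldots$. A sequence is periodic if $\sigma^t(\alpha)=\alpha$ for some $t\in\mathbb{N}$, eventually periodic if some $\sigma^t(\alpha)$ is periodic, and aperiodic if it is neither periodic nor eventually periodic. A $k$-sized window is a set $\tau=\{0=\tau(0)<\tau(1)<\cdots<\tau(k-1)\}\subset\mathbb{N}_0$. For $n\in\mathbb{N}_0$ put $\alpha[n+\tau]=\alpha_{n+\tau(0)}\alpha_{n+\tau(1)}\ldots\alpha_{n+\tau(k-1)}$ and $F_\alpha(\tau)=\{\alpha[n+\tau]:n\in\mathbb{N}_0\}$. The maximal pattern complexity of $\alpha$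 is $p^*_\alpha(k)=\sup_\tau \#F_\alpha(\tau)$, the supremum being over all $k$-sized windows $\tau$. A pattern Sturmian sequence over two letters is an aperiodic sequence $x$ over a two-letter alphabet with $p^*_x(k)=2k$ for all $k\in\mathbb{N}$. *)

(* Defs.v *)
From mathcomp Require Import all_boot all_order.
From mathcomp Require Import boolp classical_sets.

Set Implicit Arguments.
Unset Strict Implicit.
Unset Printing Implicit Defensive.

Section Sequences.
Variable A : finType.
Implicit Types (x : nat -> A) (k m n : nat).

Definition letters x : {set A} := finset (fun a => `[< exists n, x n = a >]).

Definition shift x : nat -> A := fun n => x n.+1.

Definition periodic x : Prop :=
  exists t : nat, 0 < t /\ iter t shift x =1 x.

Definition eventually_periodic x : Prop :=
  exists t : nat, periodic (iter t shift x).

Definition aperiodic x : Prop := ~ periodic x /\ ~ eventually_periodic x.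

Definition recurrent_letters x : Prop :=
  forall a : A, a \in letters x -> forall N : nat, exists n, N <= n /\ x n = a.

(* A k-sized window, given by its increasing enumeration; the first condition
   is tau(0) = 0 and leaves no window of size 0. *)
Definition window k (tau : k.-tuple nat) : Prop :=
  ohead tau = Some 0 /\ sorted ltn tau.

Definition pattern_at x n k (tau : k.-tuple nat) : k.-tuple A :=
  [tuple x (n + tnth tau j) | j < k].

Definition patterns x k (tau : k.-tuple nat) : {set k.-tuple A} :=
  finset (fun w => `[< exists n, pattern_at x n tau = w >]).

(* [supremum 0 B] is the least upper bound of B when B is nonempty and bounded,
   which holds here for k > 0 because #|patterns x tau| <= #|A| ^ k. *)
Definition max_pattern_complexity x k : nat :=
  supremum 0 (fun c : nat =>
    exists tau : k.-tuple nat, window tau /\ c = #|patterns x tau|).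

Definition pattern_sturmian x : Prop :=
  [/\ aperiodic x, #|letters x| = 2
    & forall k, 0 < k -> max_pattern_complexity x k = 2 * k].

Definition residue x m (i : nat) : nat -> A := fun n => x (i + n * m).

Definition constant_sequence x : Prop := exists a : A, forall n, x n = a.

End Sequences.

(* Main.v *)
(** Call a sequence wild if it is not eventually periodic.  For a wild [x] and
    any [T] there are [n > T] and a nonempty set [D] of letters such that every
    letter of [D] starts a block of length [T + 1] that can be followed, at
    distance [n], both by its own first letter and by another letter of [D]
    ([splits_exist]).  When [x] has a periodic limit, such an [n] is a difference
    of places where long periodic stretches break; otherwise it is a return time
    in a suitable limit of [x].

    With [T = 0], the bound [p*(2) <= l + 2] on the relation "[y] follows [x] at
    distance [n]" forces [D = {a, b}] and makes this relation a permutation on the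
    other letters.  Hence the sequence obtained by identifying [a] and [b] is
    purely periodic; let [m] be its least period.  If two residues mod [m] are not
    constant, one of them wild, some [d] separates their classes, and the same
    bound at distance [d] shows that the set of wild residues is invariant under
    translation by [d], which is contradictory.

    For the remaining residue, [p* <= 2k] follows by scaling windows by [m], and
    [p* >= 2k] by extending windows one column at a time with [splits_exist]. *)
Require Import Defs.
From mathcomp Require Import all_boot all_order.
From mathcomp Require Import boolp.
From mathcomp Require classical_sets.
From mathcomp Require Import zify.

Set Implicit Arguments.
Unset Strict Implicit.
Unset Printing Implicit Defensive.

(** * Eventual periodicity and limits *)

Section EventualPeriodicity.
Variable X : Type.
Implicit Type x : nat -> X.

Definition evp x := exists t p, 0 < p /\ forall i, t <= i -> x (i + p) = x i.

Lemma iter_shift (A : finType) t (x : nat -> A) i : iter t (@shift A) x i = x (i + t).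
Proof.
elim: t i => [|t IH] i; first by rewrite addn0.
by rewrite iterS /shift IH addSnnS.
Qed.

Lemma evp_mul x t p c : (forall i, t <= i -> x (i + p) = x i) ->
  forall i, t <= i -> x (i + c * p) = x i.
Proof.
move=> H i ti; elim: c => [|c IH]; first by rewrite addn0.
by rewrite mulSn addnCA addnC -IH H //; lia.
Qed.

Lemma evp_tail x s : evp (fun i => x (i + s)) -> evp x.
Proof.
move=> [t [p [p0 H]]]; exists (t + s), p; split=> // i ti.
have := H (i - s); rewrite addnAC subnK; last by lia.
by apply; lia.
Qed.

Lemma evp_shift x s : evp x -> evp (fun i => x (i + s)).
Proof.
move=> [t [p [p0 H]]]; exists t, p; split=> // i ti.
by rewrite addnAC H //; lia.
Qed.

Lemma evp_family (C : finType) (x : C -> nat -> X) : (forall c, evp (x c)) ->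
  exists t p, 0 < p /\ forall c i, t <= i -> x c (i + p) = x c i.
Proof.
move=> /choice [t] /choice [p] H.
exists (\max_c t c), (\prod_c p c); split.
  by apply: prodn_cond_gt0 => c _; case: (H c).
move=> c i ti; rewrite (bigD1 c) //= mulnC.
have [_ Hc] := H c; apply: (evp_mul _ Hc).
by apply: leq_trans ti; apply: leq_bigmax.
Qed.

End EventualPeriodicity.

Lemma evp_pair (X Y : Type) (x : nat -> X) (y : nat -> Y) :
  evp x -> evp y -> evp (fun i => (x i, y i)).
Proof.
move=> [t [p [p0 H]]] [s [q [q0 K]]]; exists (t + s), (p * q).
split; first by rewrite muln_gt0 p0.
move=> i ti; congr pair; first by rewrite mulnC; apply: (evp_mul q H); lia.
by apply: (evp_mul p K); lia.
Qed.

Lemma evp_eq (X Y : Type) (x : nat -> X) (y : nat -> Y) :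
  (forall i j, x i = x j -> y i = y j) -> evp x -> evp y.
Proof.
move=> xy [t [p [p0 H]]]; exists t, p; split=> // i /H; exact: xy.
Qed.

Lemma evpE (A : finType) (x : nat -> A) : eventually_periodic x <-> evp x.
Proof.
split.
  move=> [t [p [p0 H]]]; exists t, p; split=> // i ti.
  have := H (i - t); rewrite !iter_shift subnK // => <-.
  by congr x; lia.
move=> [t [p [p0 H]]]; exists t, p; split=> // i.
by rewrite !iter_shift addnAC H //; lia.
Qed.

Lemma aperiodicE (A : finType) (x : nat -> A) : aperiodic x <-> ~ evp x.
Proof.
split; first by move=> [_ N] /evpE.
by move=> N; split; [move=> P; apply: N; apply/evpE; exists 0 | move/evpE].
Qed.

Lemma pigeonhole_frequently (C : finType) (P : nat -> C -> Prop) :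
  (forall M, exists L, M <= L /\ exists c, P L c) ->
  exists c, forall M, exists L, M <= L /\ P L c.
Proof.
move=> H; apply: contrapT => /forallNP N.
have /choice [M HM] : forall c, exists M, forall L, M <= L -> ~ P L c.
  move=> c; have /existsNP [M K] := N c.
  by exists M => L ML PL; apply: K; exists L.
have [L [ML [c PL]]] := H (\max_c M c).
by apply: (HM c L) => //; apply: leq_trans ML; apply: leq_bigmax.
Qed.

Lemma pigeonhole_collision (C : finType) (f : nat -> C) :
  exists i j, i < j /\ f i = f j.
Proof.
have [|c H] := @pigeonhole_frequently C (fun i c => f i = c).
  by move=> M; exists M; split=> //; exists (f M).
have [i [_ fi]] := H 0; have [j [ij fj]] := H i.+1.
by exists i, j; rewrite fi fj.
Qed.

(** Inside a class modulo [n] the value can change only once, from false to true. Infinitely many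
    failures of [n]-periodicity would put two such changes into one class. *)
Lemma evp_mono (p : nat -> bool) n : 0 < n -> (forall i, p i -> p (i + n)) -> evp p.
Proof.
move=> n0 mono; apply: contrapT => N.
have [|[r rn] H] := @pigeonhole_frequently 'I_n
  (fun i r => [/\ ~~ p i, p (i + n) & i %% n = r]).
  move=> M; apply: contrapT => K; apply: N; exists M, n; split=> // i Mi.
  apply/idP/idP; last exact: mono.
  move=> pin; apply: contraT => npi; case: K; exists i; split=> //.
  by exists (Ordinal (ltn_pmod i n0)).
have [i [_ [_ pin /= ir]]] := H 0.
have [j [ij [npj _ /= jr]]] := H (i + n).
case/negP: npj.
have -> : j = i + n + (j %/ n - i %/ n - 1) * n.
  have := divn_eq i n; have := divn_eq j n; rewrite ir jr => -> ->.
  have := divn_eq i n; have := divn_eq j n; rewrite ir jr.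
  rewrite !divnMDl // (divn_small rn) !addn0.
  set u := i %/ n; set v := j %/ n => ev eu.
  have uv : u < v by rewrite -(ltn_pmul2r n0); lia.
  have -> : v * n = (u + (v - u - 1) + 1) * n by congr (_ * _); lia.
  rewrite !mulnDl; lia.
elim: (_ - 1) => [|c IH]; first by rewrite addn0.
by rewrite mulSn addnCA addnC; apply: mono.
Qed.

Section OrbitClosure.
Variable A : finType.
Implicit Types x y z : nat -> A.

(** The closure of the shift orbit of [x] in the product topology. *)
Definition in_orbit_closure x y := forall M, exists s, forall i, i < M -> y i = x (s + i).

Lemma orbit_closure_refl x : in_orbit_closure x x.
Proof. by move=> M; exists 0. Qed.

Lemma orbit_closure_trans x y z :
  in_orbit_closure x y -> in_orbit_closure y z -> in_orbit_closure x z.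
Proof.
move=> xy yz M; have [s H] := yz M; have [r K] := xy (s + M).
by exists (r + s) => i iM; rewrite H // K ?addnA //; lia.
Qed.

Lemma orbit_closure_shift x t : in_orbit_closure x (fun i => x (i + t)).
Proof. by move=> M; exists t => i _; rewrite addnC. Qed.

(** A Koenig argument: a prefix grows by one letter at a time and keeps occurring at [s L] for
    arbitrarily large [L]. *)
Lemma orbit_compact x (s : nat -> nat) :
  exists y, forall M, exists L, M <= L /\ forall i, i < M -> y i = x (s L + i).
Proof.
pose good w := forall M, exists L,
  M <= L /\ forall i, i < size w -> nth (x 0) w i = x (s L + i).
have ext w : exists a, good w -> good (rcons w a).
  have [gw|] := pselect (good w); last by exists (x 0).
  have [|a H] := @pigeonhole_frequently A (fun L a => x (s L + size w) = a /\
     forall i, i < size w -> nth (x 0) w i = x (s L + i)).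
    by move=> M; have [L [ML H]] := gw M; exists L; split=> //; exists (x (s L + size w)).
  exists a => _ M; have [L [ML [La K]]] := H M; exists L; split=> // i.
  rewrite size_rcons ltnS leq_eqVlt nth_rcons => /predU1P [->|iw].
    by rewrite ltnn eqxx.
  by rewrite iw K.
have [f Hf] := choice ext.
pose w n := iter n (fun v => rcons v (f v)) [::].
have szw n : size (w n) = n by elim: n => //= n IH; rewrite size_rcons IH.
have gw n : good (w n).
  by elim: n => [|n IH]; [move=> M; exists M | apply: Hf].
have nw n i : i < n -> nth (x 0) (w n) i = f (w i).
  elim: n => //= n IH; rewrite ltnS leq_eqVlt nth_rcons szw => /predU1P [->|lt].
    by rewrite ltnn eqxx.
  by rewrite lt IH.
exists (fun i => f (w i)) => M; have [L [ML H]] := gw M M.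
by exists L; split=> // i iM; rewrite -(nw M) // H ?szw.
Qed.

End OrbitClosure.

(** * Splitting blocks *)

Section Splitting.
Variable A : finType.
Implicit Types x y z : nat -> A.

(** As the second follower is again in [D] and differs from [a], it starts a splitting block of its
    own. So there are always two distinct blocks with two continuations each. *)
Definition splits x T n (D : {set A}) : Prop :=
  D != set0 /\ forall a, a \in D -> exists j j',
    [/\ forall t, t <= T -> x (j + t) = x (j' + t),
        x j = a, x (j + n) = a, x (j' + n) != a & x (j' + n) \in D].

(** [x] contains the prefix of [y] of length [L + q] but cannot stay [q]-periodic from there on; the
    first failure comes after at least [L] agreements. *)
Lemma break_after_stretch x y q L : ~ evp x -> in_orbit_closure x y -> 0 < q ->
  (forall i, y (i + q) = y i) ->
  exists e, [/\ L + q <= e, x e != x (e - q)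
    & forall i, e - L <= i < e -> x i = x (i - q)].
Proof.
move=> Nx xy q0 yq; have [s H] := xy (L + q).
have ex : exists i, x (s + i + q) != x (s + i).
  apply: contrapT => /forallNP K; apply: Nx; exists s, q; split=> // i si.
  by apply/eqP; have /negP := K (i - s); rewrite subnKC // negbK.
have lei : L <= ex_minn ex.
  case: ex_minnP => i ni _; rewrite leqNgt; apply/negP => iL.
  by case/negP: ni; rewrite -addnA -!H ?yq //; lia.
move: lei; case: ex_minnP => i ni mini Li.
exists (s + i + q); rewrite addnK; split=> // [|j ij]; first by lia.
apply/eqP; apply: contraT => nj; have := mini (j - q - s).
have -> : s + (j - q - s) + q = j by lia.
have -> : s + (j - q - s) = j - q by lia.
by move=> /(_ nj); lia.
Qed.

(* If long [q]-periodic stretches occur, let [e] be the place where a stretch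
   breaks.  Among breaks of the same colour (same block, same residue mod [q])
   choose [ec < ea < eb < ed], each preceded by a stretch much longer than the
   previous break.  With [n = eb - ea], a break is moved by [n] to a break
   ([ea] to [eb]) or into a stretch ([ec]), and a position in a stretch is moved
   to a break ([ed - n]) or stays in the stretch ([ed - n - q]). *)
Lemma splits_periodic x y q T : ~ evp x -> in_orbit_closure x y -> 0 < q ->
  (forall i, y (i + q) = y i) ->
  exists n D, T < n /\ splits x T n D.
Proof.
move=> Nx xy q0 yq.
have br := break_after_stretch _ Nx xy q0 yq.
pose col e : {ffun 'I_T.+1 -> A} * 'I_q * A :=
  ([ffun t : 'I_T.+1 => x (e + t)], Ordinal (ltn_pmod e q0), x (e - q)).
have [|c Hc] := @pigeonhole_frequently _ (fun L c => exists e,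
    [/\ L + q <= e, x e != x (e - q), col e = c
      & forall i, e - L <= i < e -> x i = x (i - q)]).
  move=> M; exists M; split=> //; have [e [? ? ?]] := br M.
  by exists (col e), e.
have {}Hc L : exists e, [/\ L + q <= e, x e != x (e - q), col e = c
      & forall i, e - L <= i < e -> x i = x (i - q)].
  have [L' [LL' [e [? ? ? K]]]] := Hc L; exists e; split=> // [|i ie]; first by lia.
  by apply: K; lia.
(* Periodicity is followed backwards from [e - q], since it fails at the break [e] itself. *)
have per e L h : (forall i, e - L <= i < e -> x i = x (i - q)) ->
    h.+1 * q <= L + q -> L + q <= e -> x (e - h.+1 * q) = x (e - q).
  move=> K; elim: h => [|h IH] hL Le; first by rewrite mul1n.
  rewrite -IH; [|by lia|by []].
  have -> : e - h.+2 * q = e - h.+1 * q - q by rewrite mulSn; lia.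
  by rewrite -K //; rewrite !mulSn in hL *; lia.
have [ec [_ brc colc _]] := Hc 0.
have [ea [lea bra cola _]] := Hc ec.+1.
have [eb [leb brb colb Kb]] := Hc (ea + T + 1).
have [ed [led brd cold Kd]] := Hc (eb + T + q).
have same e e' : col e = c -> col e' = c ->
    [/\ forall t, t <= T -> x (e + t) = x (e' + t), e %% q = e' %% q
      & x (e - q) = x (e' - q)].
  move=> <- [/ffunP K L M]; split=> // t tT.
  by have := K (Ordinal (tT : t < T.+1)); rewrite !ffunE.
have [ca_blk ca_mod ca_pre] := same _ _ colc cola.
have [ab_blk ab_mod ab_pre] := same _ _ cola colb.
have [bd_blk bd_mod bd_pre] := same _ _ colb cold.
have multq e e' : e %% q = e' %% q -> e < e' -> exists h, e' - e = h.+1 * q.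
  move=> ee' lt; have /dvdnP [[|h] E] : q %| e' - e by rewrite -eqn_mod_dvd ?ee' // ltnW.
    by lia.
  by exists h.
have lt_ca : ec < ea by lia.
have lt_ab : ea < eb by lia.
have [g Hg] := multq _ _ ca_mod lt_ca.
have [h Hh] := multq _ _ ab_mod lt_ab.
have xab : x ea = x eb by have := ab_blk 0 isT; rewrite !addn0.
have xbd : x eb = x ed by have := bd_blk 0 isT; rewrite !addn0.
(* The letter found at the breaks, and the one that the period predicts there. *)
exists (eb - ea), [set x eb; x (eb - q)]; split; first by lia.
split; first by apply/set0Pn; exists (x eb); rewrite !inE eqxx.
have xdn : x (ed - (eb - ea)) = x (eb - q).
  by rewrite Hh (per _ (eb + T + q)) //; lia.
have xcn : x (ec + (eb - ea)) = x (eb - q).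
  have -> : ec + (eb - ea) = eb - g.+1 * q by rewrite -Hg; lia.
  by rewrite (per _ (ea + T + 1)) // -Hg; lia.
have shift_ed i : ed - (eb + T + q) <= i < ed -> x (i - q) = x i by move=> /Kd ->.
move=> a; rewrite !inE => /orP [] /eqP ->.
  exists ea, ec; rewrite subnKC ?(ltnW lt_ab) //; split=> //.
  - by move=> t tT; rewrite ca_blk.
  - by rewrite xcn eq_sym.
  - by rewrite xcn !inE eqxx orbT.
have e1 : ed - (eb - ea) - q + (eb - ea) = ed - q by lia.
have e2 : ed - (eb - ea) + (eb - ea) = ed by lia.
exists (ed - (eb - ea) - q), (ed - (eb - ea)); rewrite e1 e2; split=> //.
- move=> t tT; have -> : ed - (eb - ea) - q + t = ed - (eb - ea) + t - q by lia.
  by apply: shift_ed; lia.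
- by rewrite shift_ed //; lia.
- by rewrite -xbd.
- by rewrite -xbd !inE eqxx.
Qed.

Definition block T y i : {ffun 'I_T.+1 -> A} := [ffun t : 'I_T.+1 => y (i + t)].

Definition blocks T y : {set {ffun 'I_T.+1 -> A}} :=
  finset (fun w => `[< exists i, block T y i = w >]).

Lemma mem_blocks T y i : block T y i \in blocks T y.
Proof. by rewrite inE; apply/asboolP; exists i. Qed.

Lemma block_eq T y z i j : (forall t, t <= T -> y (i + t) = z (j + t)) ->
  block T y i = block T z j.
Proof. by move=> H; apply/ffunP => t; rewrite !ffunE H // -ltnS. Qed.

Lemma eq_block T y z i j t : block T y i = block T z j -> t <= T -> y (i + t) = z (j + t).
Proof. by move=> /ffunP H tT; have := H (Ordinal (tT : t < T.+1)); rewrite !ffunE. Qed.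

(* [pi] is a projection of some limit [y] of [x] that is eventually periodic and
   separates as many letters as possible.  It cannot be refined on any further
   limit, so no letter of a nontrivial fibre [D] of [pi] occurs eventually
   periodically. *)
Lemma maximal_projection x : (forall y, in_orbit_closure x y -> ~ evp y) ->
  exists y q (pi : A -> A) (D : {set A}),
  [/\ in_orbit_closure x y, 0 < q, forall i, pi (y (i + q)) = pi (y i),
      D != set0 /\ (forall a b, a \in D -> (b \in D) = (pi b == pi a))
    & forall z a, in_orbit_closure x z -> (forall i, pi (z (i + q)) = pi (z i)) ->
        a \in D -> ~ evp (fun i => z i == a)].
Proof.
move=> Nx.
pose Q (pi : {ffun A -> A}) := exists y, in_orbit_closure x y /\ evp (fun i => pi (y i)).
have Q0 : `[< Q [ffun=> x 0] >].
  apply/asboolP; exists x; split; first exact: orbit_closure_refl.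
  by exists 0, 1; split=> // i _; rewrite !ffunE.
have [pi /asboolP [y [xy [t [q [q0 yq]]]]] maxpi] := 
  @arg_maxnP _ [ffun=> x 0] (fun pi => `[< Q pi >]) (fun pi => #|pi @: setT|) Q0.
have perE z : (forall i, pi (z (i + q)) = pi (z i)) -> evp (fun i => pi (z i)).
  by move=> zq; exists 0, q; split=> // i _.
pose y' i := y (i + t).
have xy' : in_orbit_closure x y'.
  exact: orbit_closure_trans xy (orbit_closure_shift _ _).
have y'q i : pi (y' (i + q)) = pi (y' i) by rewrite /y' addnAC yq //; lia.
have [a1 [a2 [a12 pa12]]] : exists a1 a2, a1 != a2 /\ pi a1 = pi a2.
  apply: contrapT => N; apply: (Nx _ xy'); apply: evp_eq (perE _ y'q) => i j pij.
  by apply/eqP; apply: contraT => nij; case: N; exists (y' i), (y' j).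
(* [pi] is not injective on the finite type [A], so it misses a value, which is free to receive
   [a]. *)
have [v0 v0N] : exists v0, v0 \notin pi @: setT.
  apply: contrapT => N; have : #|pi @: setT| == #|[set: A]|.
    rewrite (_ : pi @: setT = setT) //; apply/setP => v; rewrite in_setT.
    by apply: contraT => vN; case: N; exists v.
  move/imset_injP => /(_ _ _ (in_setT _) (in_setT _) pa12) e.
  by rewrite e eqxx in a12.
exists y', q, pi, [set b | pi b == pi a1]; split=> //.
  split; first by apply/set0Pn; exists a1; rewrite inE.
  by move=> a b; rewrite !inE => /eqP ->.
move=> z a xz zq; rewrite inE => /eqP paa1 eva.
pose pi' := [ffun b => if b == a then v0 else pi b].
have Qpi' : `[< Q pi' >].
  apply/asboolP; exists z; split=> //.
  apply: evp_eq (evp_pair eva (perE _ zq)) => i j [ea epi].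
  by rewrite !ffunE ea epi.
have := maxpi _ Qpi'; apply/negP; rewrite -ltnNge.
have -> : #|pi @: setT|.+1 = #|v0 |: pi @: setT| by rewrite cardsU1 v0N.
apply/subset_leq_card/subsetP => v /setU1P [->|/imsetP [b _ ->]].
  by apply/imsetP; exists a; rewrite // ffunE eqxx.
have [->|nba] := eqVneq b a; last first.
  by apply/imsetP; exists b; rewrite // ffunE (negPf nba).
(* The value [pi a] is still attained by [pi'], at another letter of the fibre, so the image has
   grown by [v0]. *)
pose b' := if a1 == a then a2 else a1.
apply/imsetP; exists b' => //; rewrite ffunE /b'.
have [e|/negPf n1] := eqVneq a1 a; last by rewrite n1 paa1.
by rewrite -e eq_sym (negPf a12) pa12.
Qed.

(** Take [y] with the fewest blocks. If some block left arbitrarily long gaps, a limit of these gaps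
    would lose that block and gain none. *)
Lemma minimal_blocks (P : (nat -> A) -> Prop) T :
  (exists y, P y) -> (forall y z, P y -> in_orbit_closure y z -> P z) ->
  exists y B, P y /\ forall i s, exists t, t < B /\ block T y (s + t) = block T y i.
Proof.
move=> [y0 Py0] Pcl.
have ex : exists n, `[< exists y, P y /\ #|blocks T y| = n >].
  by exists #|blocks T y0|; apply/asboolP; exists y0.
case: (ex_minnP ex) => _ /asboolP [y [Py <-]] miny.
have /choice [B HB] : forall w, exists B, w \in blocks T y ->
    forall s, exists t, t < B /\ block T y (s + t) = w.
  move=> w; apply: contrapT => /forallNP N.
  have wy : w \in blocks T y by apply: contrapT => wN; apply: (N 0) => /wN.
  have /choice [s Hs] : forall L, exists s, forall t, t < L -> block T y (s + t) <> w.
    move=> L; apply: contrapT => /forallNP K; apply: (N L) => _ s.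
    apply: contrapT => M; apply: (K s) => t tL e; apply: M; by exists t.
  have [z Hz] := orbit_compact y s.
  have yz : in_orbit_closure y z by move=> M; have [L [_ H]] := Hz M; exists (s L).
  have := miny #|blocks T z| _; rewrite leqNgt.
  move=> /(_ (asboolT (ex_intro _ z (conj (Pcl _ _ Py yz) erefl)))) /negP; apply.
  apply: proper_card; rewrite properE; apply/andP; split.
    apply/subsetP => _ /[!inE] /asboolP [i <-].
    have [L [_ H]] := Hz (i + T).+1.
    apply/asboolP; exists (s L + i); apply: block_eq => t tT.
    by rewrite -addnA -H //; lia.
  apply/subsetPn; exists w => //; rewrite inE; apply/asboolP => -[i iw].
  have [L [LM H]] := Hz (i + T).+1.
  apply: (Hs L i); first by lia.
  by rewrite -iw; apply: block_eq => t tT; rewrite -addnA -H //; lia.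
exists y, (\max_w B w); split=> // i s.
have [t [tB e]] := HB _ (mem_blocks T y i) s.
by exists t; split=> //; apply: leq_trans tB _; apply: leq_bigmax.
Qed.

Lemma splits_orbit_closure x y T n (D : {set A}) :
  in_orbit_closure x y -> splits y T n D -> splits x T n D.
Proof.
move=> xy [D0 H]; split=> // a /H [j [j' [e ja jn jn' jnD]]].
have [s K] := xy (j + j' + n + T).+1.
exists (s + j), (s + j'); rewrite -!addnA -!K; try by lia.
split=> // t tT; rewrite -!addnA -!K ?e //; lia.
Qed.

(** Blocks of length [T + 1] recur in [y] with gaps bounded by [B], so each of them occurs inside a
    longer block repeated at distance [n], where its first letter returns after [n]. If [a] were
    always followed by [a] at distance [n], its occurrences would be eventually periodic by
    [evp_mono], against the choice of [D]. *)
Lemma splits_aperiodic x T : (forall y, in_orbit_closure x y -> ~ evp y) ->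
  exists n D, T < n /\ splits x T n D.
Proof.
move=> /maximal_projection [y0 [q [pi [D [xy0 q0 y0q [D0 Dpi] ND]]]]].
pose P y := in_orbit_closure x y /\ forall i, pi (y (i + q)) = pi (y i).
have [| |y [B [[xy yq] rec]]] := @minimal_blocks P T.
- by exists y0.
- move=> y z [xy yq] yz; split; first exact: orbit_closure_trans xy yz.
  move=> i; have [s H] := yz (i + q).+1.
  by rewrite !H ?addnA //; lia.
(* Return times that are multiples of [K] exceed [T] and preserve [pi]. *)
pose K := q * T.+1.
have [i [j [ij eij]]] := pigeonhole_collision (fun i => block (B + T) y (i * K)).
pose n := (j - i) * K.
have ret t : t <= B + T -> y (i * K + t + n) = y (i * K + t).
  move=> tB; rewrite (eq_block eij) // addnAC; congr (y (_ + _)).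
  by rewrite /n mulnBl subnKC // leq_mul2r ltnW ?orbT.
have nT : T < n.
  by rewrite /n /K mulnA leq_pmull // muln_gt0 subn_gt0 ij.
have piE k : pi (y (k + n)) = pi (y k).
  rewrite (_ : n = ((j - i) * T.+1) * q); last by rewrite /n /K; lia.
  by apply: (@evp_mul _ (fun i => pi (y i)) 0) => // i' _.
exists n, D; split=> //; apply: (splits_orbit_closure xy); split=> // a aD.
have [j' [j'a j'n]] : exists j', y j' = a /\ y (j' + n) != a.
  apply: contrapT => N; apply: (ND y a xy yq aD).
  apply: (@evp_mono _ n); first by lia.
  move=> k /eqP ka; apply: contraT => kn; case: N; by exists k.
have [t [tB e]] := rec j' (i * K).
exists (i * K + t), j'.
have e0 : y (i * K + t) = a by rewrite -j'a -[_ + t]addn0 -[in RHS](addn0 j') (eq_block e).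
split=> //; first by move=> u uT; rewrite (eq_block e).
  by rewrite ret ?e0 //; lia.
by rewrite (Dpi a) // piE j'a.
Qed.

Lemma splits_exist x T : ~ evp x -> exists n D, T < n /\ splits x T n D.
Proof.
move=> Nx.
have [[y [xy [t [q [q0 yq]]]]]|N] := pselect (exists y, in_orbit_closure x y /\ evp y).
  apply: (@splits_periodic x (fun i => y (i + t)) q) => //.
    exact: orbit_closure_trans xy (orbit_closure_shift _ _).
  by move=> i; rewrite addnAC yq //; lia.
by apply: splits_aperiodic => y xy ey; apply: N; exists y.
Qed.

End Splitting.

(** * Counting patterns *)

Section Counting.
Variables X Y : finType.

(** One edge [g x] for each [x] in [L], and one more at each of [x1] and [x2], are [#|L| + 2] edges.
    If there are no others, every further point has one successor and [x1] has two; the claim for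
    [x2] follows by exchanging the roles. *)
Lemma relation_excess (E : {set X * Y}) (L : {set X}) x1 x2 y1 y1' y2 y2' :
  (forall x, x \in L -> exists y, (x, y) \in E) ->
  x1 \in L -> x2 \in L -> x1 != x2 -> y1 != y1' -> y2 != y2' ->
  (x1, y1) \in E -> (x1, y1') \in E -> (x2, y2) \in E -> (x2, y2') \in E ->
  #|L| + 2 <= #|E| /\
  (#|E| <= #|L| + 2 ->
    (forall x y y', x \in L -> x != x1 -> x != x2 ->
       (x, y) \in E -> (x, y') \in E -> y = y') /\
    (forall y, (x1, y) \in E -> y = y1 \/ y = y1')).
Proof.
move=> tot x1L x2L x12 y11 y22 e1 e1' e2 e2'.
have /choice [g Hg] : forall x, exists y, x \in L -> (x, y) \in E.
  move=> x; have [/tot [y xy]|xL] := boolP (x \in L); first by exists y.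
  by exists y1.
have extra x y y' : y != y' -> (x, y) \in E -> (x, y') \in E ->
    exists z, [/\ (x, z) \in E, z != g x & z = y \/ z = y'].
  move=> yy' xy xy'; have [yg|yg] := eqVneq y (g x).
    by exists y'; rewrite -yg eq_sym; split=> //; right.
  by exists y; split=> //; left.
have [z1 [z1E z1g z1y]] := extra _ _ _ y11 e1 e1'.
have [z2 [z2E z2g _]] := extra _ _ _ y22 e2 e2'.
pose E0 := [set (x, g x) | x in L].
pose E1 := (x1, z1) |: ((x2, z2) |: E0).
have N x z : z != g x -> (x, z) \notin E0.
  by apply: contraNN => /imsetP [x' _ [-> ->]].
have cE1 : #|E1| = #|L| + 2.
  rewrite cardsU1 inE negb_or N // in_set1 xpair_eqE (negPf x12) /=.
  by rewrite cardsU1 N // card_imset => [|x x' []] //; lia.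
have E1E : E1 \subset E.
  rewrite !subUset !sub1set z1E z2E /=.
  by apply/subsetP => _ /imsetP [x xL ->]; apply: Hg.
rewrite -cE1; split; first exact: subset_leq_card.
move=> le; have EE : E = E1 by apply/eqP; rewrite eq_sym eqEcard E1E.
have memE x y : (x, y) \in E -> [\/ y = g x, x = x1 /\ y = z1 | x = x2].
  rewrite EE !inE => /or3P [/eqP [-> ->]|/eqP [-> _]|/imsetP [x' _ [-> ->]]].
  - by constructor 2.
  - by constructor 3.
  - by constructor 1.
split.
  move=> x y y' _ /eqP n1 /eqP n2 /memE [->|[/n1 //]|/n2 //].
  by move=> /memE [->|[/n1 //]|/n2 //].
have x12' : x1 <> x2 by apply/eqP.
have inj y : (x1, y) \in E -> y = g x1 \/ y = z1.
  by move=> /memE [->|[_ ->]|/x12' //]; [left | right].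
have nyy : y1 <> y1' by apply/eqP.
move=> y /inj; case: (inj _ e1); case: (inj _ e1'); case: z1y; intuition congruence.
Qed.

End Counting.

(** * Patterns of windows and the lower bound for complexity *)

Section Complexity.
Variable A : finType.
Implicit Type x : nat -> A.

Lemma window_cons k (tau : k.-tuple nat) : window tau ->
  exists2 s, tau = 0 :: s :> seq nat & path ltn 0 s.
Proof. by case: tau => -[|t s] sz [] //= [->] srt; exists s. Qed.

Lemma card_patterns_le x k (tau : k.-tuple nat) :
  window tau -> #|patterns x tau| <= max_pattern_complexity x k.
Proof.
move=> wt; rewrite -leEnat; apply: classical_sets.ge_supremum_Nmem; last by exists tau.
apply: classical_sets.nat_supremums_neq0; exists #|{: k.-tuple A}| => _ [tau' [_ ->]].
by rewrite leEnat; apply: max_card.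
Qed.

Lemma max_pattern_complexity_le x k (tau : k.-tuple nat) N : window tau ->
  (forall tau' : k.-tuple nat, window tau' -> #|patterns x tau'| <= N) ->
  max_pattern_complexity x k <= N.
Proof.
move=> wt H; rewrite /max_pattern_complexity /classical_sets.supremum; case: ifP => // _.
case: classical_sets.xgetP => // y _ [_]; rewrite -leEnat; apply.
by move=> _ [tau' [w ->]]; rewrite leEnat; apply: H.
Qed.

Lemma pattern_in x k (tau : k.-tuple nat) n : pattern_at x n tau \in patterns x tau.
Proof. by rewrite inE; apply/asboolP; exists n. Qed.

(** The patterns of the window with entries 0 and [d], as a relation to which [relation_excess]
    applies. *)
Definition edges x d : {set A * A} :=
  finset (fun p => `[< exists j, x j = p.1 /\ x (j + d) = p.2 >]).

Lemma edgesP x d a b : reflect (exists j, x j = a /\ x (j + d) = b) ((a, b) \in edges x d).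
Proof. by rewrite inE; apply: asboolP. Qed.

Lemma mem_edges x d j : (x j, x (j + d)) \in edges x d.
Proof. by apply/edgesP; exists j. Qed.

Lemma card_edges_le x d : 0 < d -> #|edges x d| <= max_pattern_complexity x 2.
Proof.
move=> d0; have w : window [tuple 0; d] by split=> //=; rewrite d0.
apply: leq_trans (card_patterns_le x w).
apply: leq_trans (leq_imset_card (fun p => (tnth p ord0, tnth p ord_max)) _).
apply: subset_leq_card; apply/subsetP => -[a b] /edgesP [j [<- <-]].
apply/imsetP; exists (pattern_at x j [tuple 0; d]); first exact: pattern_in.
by rewrite !tnth_mktuple !(tnth_nth 0) /= addn0.
Qed.

Lemma letterP x a : reflect (exists n, x n = a) (a \in letters x).
Proof. by rewrite inE; apply: asboolP. Qed.

(** A pattern of the longer window is an edge from a pattern of [tau] to a letter. Splitting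
    provides two patterns of [tau] with two successors each, so [relation_excess] adds 2. *)
Lemma patterns_ge x a b k : ~ evp x -> (forall n, x n = a \/ x n = b) ->
  exists tau : k.+1.-tuple nat, window tau /\ 2 * k.+1 <= #|patterns x tau|.
Proof.
move=> Nx xab; elim: k => [|k [tau [wt IH]]].
  exists [tuple 0]; split; first by split.
  apply/card_gt1P.
  have [n xn] : exists n, x n != x 0.
    apply: contrapT => N; apply: Nx; exists 0, 1; split=> // i _.
    have E j : x j = x 0 by apply/eqP; apply: contraT => nj; case: N; exists j.
    by rewrite !E.
  exists (pattern_at x n [tuple 0]), (pattern_at x 0 [tuple 0]).
  split; try exact: pattern_in.
  apply: contraNN xn => /eqP /(congr1 (fun w => tnth w ord0)).
  by rewrite !tnth_mktuple (tnth_nth 0) /= !addn0 => ->.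
have [s etau srt] := window_cons wt.
(* Equal blocks of length [T + 1] have equal patterns along [tau], and any [n > T] can be appended
   to the window. *)
pose T := \max_(t <- tau) t.
have tauT t : t \in tau -> t <= T by move=> tt; apply: leq_bigmax_seq.
have [n [D [nT [D0 HD]]]] := splits_exist T Nx.
have wt' : window (rcons_tuple tau n).
  rewrite /window /= etau rcons_cons /= rcons_path srt; split=> //=.
  by apply: leq_ltn_trans nT; apply: tauT; have := mem_last 0 s; rewrite -etau.
exists (rcons_tuple tau n); split=> //.
pose h (w : k.+2.-tuple A) :=
  ([tuple tnth w (widen_ord (leqnSn k.+1) j) | j < k.+1], tnth w ord_max).
have hE j : h (pattern_at x j (rcons_tuple tau n)) = (pattern_at x j tau, x (j + n)).
  congr pair; last first.
    by rewrite tnth_mktuple (tnth_nth 0) /= nth_rcons size_tuple ltnn eqxx.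
  apply: eq_from_tnth => i; rewrite !tnth_mktuple; congr (x (_ + _)).
  by rewrite !(tnth_nth 0) /= nth_rcons size_tuple ltn_ord.
pose E := h @: patterns x (rcons_tuple tau n).
have memE j : (pattern_at x j tau, x (j + n)) \in E.
  by rewrite -hE imset_f ?pattern_in.
apply: leq_trans (leq_imset_card h _); rewrite -/E mulnS addnC.
have HD' c : c \in D -> exists u y y', [/\ u \in patterns x tau, tnth u ord0 = c,
    y != y', y = c & y' \in D] /\ (u, y) \in E /\ (u, y') \in E.
  move=> /HD [j [j' [e jc jn jn' jD]]].
  exists (pattern_at x j tau), (x (j + n)), (x (j' + n)).
  split; last first.
    split=> //; have -> : pattern_at x j tau = pattern_at x j' tau => //.
    apply: eq_from_tnth => i; rewrite !tnth_mktuple e //.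
    by apply: tauT; apply: mem_tnth.
  split=> //; first exact: pattern_in; last by rewrite jn eq_sym.
  by rewrite tnth_mktuple (tnth_nth 0) etau addn0.
have /set0Pn [c cD] := D0.
have [u [y [y' [[uF uc yy' yc yD'] [uE uE']]]]] := HD' _ cD.
have [v [z [z' [[vF vc zz' zc zD'] [vE vE']]]]] := HD' _ yD'.
have uv : u != v by apply: contraNneq yy' => uv; rewrite -vc -uv uc yc.
have tot w : w \in patterns x tau -> exists y, (w, y) \in E.
  by rewrite inE => /asboolP [j <-]; exists (x (j + n)).
have [le _] := relation_excess tot uF vF uv yy' zz' uE uE' vE vE'.
by apply: leq_trans le; rewrite leq_add2r.
Qed.

End Complexity.

(** * The two exceptional letters and the collapsed sequence *)

Lemma pure_period (K : finType) (ka : nat -> K) n : 0 < n ->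
  (forall i j, ka i = ka j <-> ka (i + n) = ka (j + n)) ->
  exists p, [/\ 0 < p, forall j, ka (j + p) = ka j
    & forall q, 0 < q -> (forall j, ka (j + q) = ka j) -> p <= q].
Proof.
move=> n0 kan.
have kanc c i j : ka i = ka j <-> ka (i + c * n) = ka (j + c * n).
  by elim: c => [|c IH]; rewrite ?addn0 // !mulSnr !addnA -kan.
(* Moving by [n] acts injectively on the finitely many values of [ka]. With a representative [s v]
   of each value [v], two iterates of this action coincide, and injectivity cancels the earlier
   one. *)
have ex : exists p, `[< 0 < p /\ forall j, ka (j + p) = ka j >].
  have /choice [s Hs] : forall v, exists j, forall i, ka i = v -> ka j = v.
    move=> v; have [[i iv]|N] := pselect (exists i, ka i = v); first by exists i.
    by exists 0 => i iv; case: N; exists i.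
  have [i [i' [ii' /ffunP e]]] := pigeonhole_collision (fun i => [ffun v => ka (s v + i * n)]).
  exists ((i' - i) * n); apply/asboolP; split; first by rewrite muln_gt0 subn_gt0 ii'.
  move=> j; have := e (ka j); rewrite !ffunE.
  have sj : ka (s (ka j)) = ka j by exact: (Hs _ j).
  have /(kanc i) -> := sj; have /(kanc i') -> := sj.
  move=> E; symmetry; apply/(kanc i).
  by rewrite E -addnA -mulnDl subnK // ltnW.
case: (ex_minnP ex) => p /asboolP [p0 pp] pmin; exists p; split=> // q q0 qp.
by apply: pmin; apply/asboolP.
Qed.

Section Structure.
Variables (A : finType) (x : nat -> A).
Hypothesis Nx : ~ evp x.
Hypothesis edges2 : forall d, 0 < d -> #|edges x d| <= #|letters x| + 2.

Let out a d : a \in letters x -> exists b, (a, b) \in edges x d.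
Proof. by move=> /letterP [j <-]; exists (x (j + d)); apply: mem_edges. Qed.

Definition collapse (D : {set A}) (c : A) : option A := if c \in D then None else Some c.

(** [a] and [b] use up the whole excess of the relation at distance [n], so every other letter has a
    single successor. The same count for the reversed relation gives single predecessors, hence the
    equivalence. *)
Lemma two_letter_core : recurrent_letters x ->
  exists a b n, [/\ a \in letters x, b \in letters x, a != b, 0 < n
    & forall i j, collapse [set a; b] (x i) = collapse [set a; b] (x j) <->
        collapse [set a; b] (x (i + n)) = collapse [set a; b] (x (j + n))].
Proof.
move=> rec.
have [n [D [n0 [D0 HD]]]] := splits_exist 0 Nx.
have {}HD c : c \in D -> [/\ c \in letters x, (c, c) \in edges x n
    & exists c', [/\ c' \in D, c' != c & (c, c') \in edges x n]].
  move=> /HD [j [j' [e jc jn jn' jD]]]; split.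
  - by apply/letterP; exists j.
  - by rewrite -[X in (X, _)]jc -jn mem_edges.
  - exists (x (j' + n)); split=> //; rewrite -jc -[x j](congr1 x (addn0 j)) e // addn0.
    exact: mem_edges.
have /set0Pn [a aD] := D0.
have [aL aa [b [bD ba ab]]] := HD _ aD.
have [bL bb [c [cD cb bc]]] := HD _ bD.
have nab : a != b by rewrite eq_sym.
have [_ /(_ (edges2 n0)) [out1 outa]] :=
  relation_excess (@out ^~ n) aL bL nab nab (cb : c != b) aa ab bc bb.
(* Otherwise [c], being in [D], would be a third letter with two successors. *)
have ca : c = a.
  apply/eqP; apply: contraT => ca; have [cL cc [d [_ dc cd]]] := HD _ cD.
  by rewrite (out1 c d c cL ca cb cd cc) eqxx in dc.
rewrite {c cD cb}ca in bc.
have [_ /(_ (edges2 n0)) [_ outb]] :=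
  relation_excess (@out ^~ n) bL aL ba nab nab bc bb aa ab.
pose E' := [set (p.2, p.1) | p in edges x n].
have E'P c d : ((c, d) \in E') = ((d, c) \in edges x n).
  apply/imsetP/idP => [[[u v] uv [-> ->]] //|dc]; by exists (d, c).
have E'2 : #|E'| <= #|letters x| + 2.
  by rewrite card_imset ?edges2 // => -[u v] [u' v'] [-> ->].
(* Recurrence provides an occurrence of [c] late enough to have a letter [n] places before it. *)
have inn c : c \in letters x -> exists d, (c, d) \in E'.
  move=> /rec /(_ n) [j [nj jc]]; exists (x (j - n)).
  by rewrite E'P -jc -[in X in (_, X)](subnK nj) mem_edges.
have [_ /(_ E'2) [in1 ina]] :=
  relation_excess inn aL bL nab nab nab
    (etrans (E'P _ _) aa) (etrans (E'P _ _) bc) (etrans (E'P _ _) ab) (etrans (E'P _ _) bb).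
have [_ /(_ E'2) [_ inb]] :=
  relation_excess inn bL aL ba nab nab
    (etrans (E'P _ _) ab) (etrans (E'P _ _) bb) (etrans (E'P _ _) aa) (etrans (E'P _ _) bc).
exists a, b, n; split=> //.
have E'm i : (x (i + n), x i) \in E' by rewrite E'P mem_edges.
have lx i : x i \in letters x by apply/letterP; exists i.
have inD i : (x (i + n) \in [set a; b]) = (x i \in [set a; b]).
  apply/idP/idP; rewrite !inE => /orP [] /eqP e.
  - by have := E'm i; rewrite e => /ina [] ->; rewrite eqxx ?orbT.
  - by have := E'm i; rewrite e => /inb [] ->; rewrite eqxx ?orbT.
  - by have := mem_edges x n i; rewrite e => /outa [] ->; rewrite eqxx ?orbT.
  - by have := mem_edges x n i; rewrite e => /outb [] ->; rewrite eqxx ?orbT.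
move=> i j; rewrite /collapse !inD.
have [iD|] := boolP (x i \in _); have [jD|] := boolP (x j \in _) => //.
rewrite !inE !negb_or => /andP [ja jb] /andP [ia ib].
split=> [[e]|[e]]; congr Some.
  by apply: (out1 (x i)); rewrite ?mem_edges // [x i in X in X \in _]e mem_edges.
apply: (in1 (x (i + n))); rewrite ?E'm //; last by rewrite e E'm.
  by have := inD i; rewrite !inE (negPf ia) (negPf ib) => /norP [].
by have := inD i; rewrite !inE (negPf ia) (negPf ib) => /norP [].
Qed.

End Structure.

(** * Residues modulo the period of the collapsed sequence *)

Section Residues.
Variables (A : finType) (x : nat -> A).
Hypothesis Nx : ~ evp x.
Hypothesis edges2 : forall d, 0 < d -> #|edges x d| <= #|letters x| + 2.
Variables (a b : A) (m : nat).
Hypotheses (aL : a \in letters x) (bL : b \in letters x) (nab : a != b) (m0 : 0 < m).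

Let ka i := collapse [set a; b] (x i).

Hypothesis kam : forall i, ka (i + m) = ka i.
Hypothesis kamin : forall q, 0 < q -> (forall i, ka (i + q) = ka i) -> m <= q.

Let ka_mul i n : ka (i + n * m) = ka i.
Proof. by apply: (@evp_mul _ ka 0) => // j _. Qed.

Let kaN i : ka i = None -> x i = a \/ x i = b.
Proof. by rewrite /ka /collapse; case: ifP => // /set2P. Qed.

Let kaS i c : ka i = Some c -> [/\ x i = c, c != a & c != b].
Proof.
rewrite /ka /collapse !inE; case: ifP => // /negbT; rewrite negb_or => /andP [? ?] [<-].
by [].
Qed.

Let ka_eq i j : x i = x j -> ka i = ka j.
Proof. by rewrite /ka => ->. Qed.

Let wild i := ~ evp (residue x m i).

Let wild_tail i c : wild (i + c * m) <-> wild i.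
Proof.
split=> W ev; apply: W.
  apply: evp_eq (evp_shift c ev) => n n'.
  by rewrite /residue !mulnDl !addnA ![i + _ + c * m]addnAC.
apply: (@evp_tail _ _ c); apply: evp_eq ev => n n'.
by rewrite /residue !mulnDl !addnA ![i + _ + c * m]addnAC.
Qed.

Let wild_mod i j : i = j %[mod m] -> wild i <-> wild j.
Proof.
move=> e; rewrite (divn_eq i m) (divn_eq j m) e ![_ * m + _]addnC !wild_tail.
by [].
Qed.

Lemma wild_varies i : wild i -> ka i = None /\ exists n, x (i + n * m) != x i.
Proof.
move=> W; have [n xn] : exists n, x (i + n * m) != x i.
  apply: contrapT => N; apply: W; exists 0, 1; split=> // n _.
  have E k : x (i + k * m) = x i.
    by apply/eqP; apply: contraT => nk; case: N; exists k.
  by rewrite /residue !E.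
split; last by exists n.
case e: (ka i) => [c|] //; have [ic _ _] := kaS e.
have := ka_mul i n; rewrite e => /kaS [jc _ _].
by rewrite jc ic eqxx in xn.
Qed.

Lemma varies_both i n : ka i = None -> x (i + n * m) != x i ->
  (exists k, x (i + k * m) = a) /\ (exists k, x (i + k * m) = b).
Proof.
move=> iN; have := kaN iN; have := ka_mul i n; rewrite iN => /kaN.
move=> e1 e2 ne; have i0 : x (i + 0 * m) = x i by rewrite addn0.
by case: e1 ne => e1; case: e2 => e2; rewrite ?e1 ?e2 ?eqxx // => _; split;
   solve [by exists n | by exists 0; rewrite i0].
Qed.

(** Otherwise the difference of [i] and [j] would be a period of [ka] smaller than [m]. *)
Lemma separate i j : i < m -> j < m -> i != j -> exists d, ka (i + d) <> ka (j + d).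
Proof.
wlog ij : i j / i < j => [W im jm nij|im jm _].
  have [lt|lt|e] := ltngtP i j; last by rewrite e eqxx in nij.
    exact: W lt im jm nij.
  have [d Hd] := W j i lt jm im (negbT (ltn_eqF lt)).
  by exists d; apply: nesym.
apply: contrapT => /forallNP N.
suff : m <= j - i by lia.
apply: kamin; first by lia.
move=> k; rewrite -(ka_mul _ i) -(ka_mul k i).
(* This distance takes [i] to [k] modulo [m]; the term [i * m] avoids truncated subtraction. *)
have /contrapT := N (k + i * m - i).
have iim : i <= i * m by rewrite leq_pmulr.
have -> : i + (k + i * m - i) = k + i * m by lia.
have -> : j + (k + i * m - i) = k + (j - i) + i * m by lia.
by [].
Qed.

(* The edges of difference [d] out of [a] and [b] already exhaust the excess: each
   of the two letters has one successor of kind [ka (i + d)] and one of kind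
   [ka (r + d)], at most one of which lies in [{a, b}].  Hence the residue at [j]
   is not constant and determines the residue at [j + d] letter by letter. *)
Lemma wild_pred i r d j : 0 < d -> wild i -> ka r = None ->
  (exists n, x (r + n * m) != x r) -> ka (i + d) <> ka (r + d) ->
  wild (j + d) -> wild j.
Proof.
move=> d0 Wi rN [n rn] sep Wj.
have [iN [n' i_n']] := wild_varies Wi.
have [[ia iaE] [ib ibE]] := varies_both iN i_n'.
have [[ra raE] [rb rbE]] := varies_both rN rn.
have tgt k l c : x (k + l * m) = c -> let y := x (k + l * m + d) in
    (c, y) \in edges x d /\ ka (k + l * m + d) = ka (k + d).
  by move=> <- /=; split; [apply: mem_edges | rewrite addnAC ka_mul].
have [e1 k1] := tgt _ _ _ iaE; have [e2 k2] := tgt _ _ _ ibE.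
have [e3 k3] := tgt _ _ _ raE; have [e4 k4] := tgt _ _ _ rbE.
have neq u v : ka u = ka (i + d) -> ka v = ka (r + d) -> x u != x v.
  by move=> ku kv; apply/eqP => /ka_eq; rewrite ku kv.
have tot c : c \in letters x -> exists y, (c, y) \in edges x d.
  by move=> /letterP [u <-]; exists (x (u + d)); apply: mem_edges.
have nba : b != a by rewrite eq_sym.
have [_ /(_ (edges2 d0)) [out1 outa]] :=
  relation_excess tot aL bL nab (neq _ _ k1 k3) (neq _ _ k2 k4) e1 e3 e2 e4.
have [_ /(_ (edges2 d0)) [_ outb]] :=
  relation_excess tot bL aL nba (neq _ _ k2 k4) (neq _ _ k1 k3) e2 e4 e1 e3.
have [jdN [k jdk]] := wild_varies Wj.
have jdN' u : ka (j + u * m + d) = None by rewrite addnAC ka_mul.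
case jN: (ka j) => [c|]; last first.
  move=> ev; apply: Wj; apply: evp_eq ev => u v; rewrite /residue => uv.
  rewrite ![j + d + _]addnAC.
  have := mem_edges x d (j + u * m); have := mem_edges x d (j + v * m); rewrite -uv.
  have := ka_mul j u; rewrite jN => /kaN [] ->.
  - move=> /outa vE /outa uE; case: uE vE => uE [] vE; rewrite uE vE //.
    + by case: sep; rewrite -k1 -k3 -(ka_eq uE) -(ka_eq vE) !jdN'.
    + by case: sep; rewrite -k1 -k3 -(ka_eq uE) -(ka_eq vE) !jdN'.
  - move=> /outb vE /outb uE; case: uE vE => uE [] vE; rewrite uE vE //.
    + by case: sep; rewrite -k2 -k4 -(ka_eq uE) -(ka_eq vE) !jdN'.
    + by case: sep; rewrite -k2 -k4 -(ka_eq uE) -(ka_eq vE) !jdN'.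
have [jc ca cb] := kaS jN.
have [jkc _ _] : [/\ x (j + k * m) = c, c != a & c != b].
  by apply: kaS; rewrite ka_mul.
case/eqP: jdk; rewrite addnAC.
apply: (out1 c) => //.
- by apply/letterP; exists j.
- by rewrite -jkc mem_edges.
- by rewrite -jc mem_edges.
Qed.

(** [i + d * m] is wild, and [m - 1] steps back by [d] with [wild_pred] lead to [i + d]. *)
Lemma wild_succ i r d : 0 < d -> wild i -> ka r = None ->
  (exists n, x (r + n * m) != x r) -> ka (i + d) <> ka (r + d) -> wild (i + d).
Proof.
move=> d0 Wi rN rn sep.
have : wild (i + d * m) by apply/wild_tail.
case: m m0 => // k _; rewrite mulnS addnA.
elim: k => [|k IH]; first by rewrite muln0 addn0.
by rewrite mulnS addnA addnAC => /(wild_pred d0 Wi rN rn sep).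
Qed.

Lemma wild_exists : exists2 i, i < m & wild i.
Proof.
apply: contrapT => N; apply: Nx.
have [|t [p [p0 H]]] := @evp_family _ 'I_m (fun i => residue x m i).
  by move=> i; apply: contrapT => W; apply: N; exists (i : nat).
exists (t * m), (p * m); split; first by rewrite muln_gt0 p0.
move=> i ti; have := H (Ordinal (ltn_pmod i m0)) (i %/ m).
rewrite /residue /= leq_divRL // mulnDl addnA => /(_ ti).
by rewrite addnC [i %% m + _]addnC -divn_eq addnC.
Qed.

(** If [d] separates two wild residues, both stay wild after moving by [d], so both land in the
    merged letter, a contradiction. A second non-constant residue [r] is then excluded as well,
    since moving by [d] must fix the only wild class. *)
Lemma one_wild_residue : exists2 i, i < m &
  wild i /\ forall r, r < m -> r != i -> forall n, x (r + n * m) = x r.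
Proof.
have [i im Wi] := wild_exists; exists i => //; split=> // r rm ri n.
apply/eqP; apply: contraT => rn.
case rN: (ka r) => [c|]; last first.
  have sep0 u d : ka u = None -> ka (i + d) <> ka (u + d) -> 0 < d.
    have [iN _] := wild_varies Wi.
    by move=> uN; case: d => //; rewrite !addn0 iN uN.
  have unique_wild u : u < m -> wild u -> u = i.
    move=> um Wu; apply/eqP; apply: contraT => ui.
    have [uN un] := wild_varies Wu.
    have [d sep] : exists d, ka (i + d) <> ka (u + d) by apply: separate; rewrite 1?eq_sym.
    have d0 := sep0 _ _ uN sep.
    have [idN _] := wild_varies (wild_succ d0 Wi uN un sep).
    have [iN i_n] := wild_varies Wi.
    have [udN _] := wild_varies (wild_succ d0 Wu iN i_n (nesym sep)).
    by case: sep; rewrite idN udN.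
  have [d sep] : exists d, ka (i + d) <> ka (r + d) by apply: separate; rewrite 1?eq_sym.
  have rn' : exists n, x (r + n * m) != x r by exists n.
  have d0 := sep0 _ _ rN sep.
  have Wid := wild_succ d0 Wi rN rn' sep.
  (* Thus [m] divides [d], and translation by [d] cannot separate [i] from [r]. *)
  have : (i + d) %% m = i.
    apply: unique_wild; first by rewrite ltn_pmod.
    by apply/(@wild_mod ((i + d) %% m) (i + d)) => //; rewrite modn_mod.
  move=> e; have /dvdnP [c dc] : m %| d.
    rewrite -[d](addKn i) -eqn_mod_dvd ?leq_addr // e modn_small //.
  by case: sep; rewrite dc !ka_mul; have [-> _] := wild_varies Wi.
have [rc _ _] := kaS rN.
have [rnc _ _] : [/\ x (r + n * m) = c, c != a & c != b].
  by apply: kaS; rewrite ka_mul.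
by rewrite rnc rc eqxx in rn.
Qed.

End Residues.

(** * Scaled windows and the conclusion *)

Lemma window_scale k (tau : k.-tuple nat) m : 0 < m -> window tau ->
  window (map_tuple (muln^~ m) tau).
Proof.
move=> m0 wt; have [s e srt] := window_cons wt.
rewrite /window /= e /= mul0n; split=> //.
rewrite -[X in path _ X](mul0n m) (@path_map _ _ (muln^~ m) ltn 0 s).
by apply: sub_path srt => i j /=; rewrite ltn_pmul2r.
Qed.

Lemma pattern_at_scale (A : finType) (x : nat -> A) k (tau : k.-tuple nat) m i n :
  pattern_at x (i + n * m) (map_tuple (muln^~ m) tau) = pattern_at (residue x m i) n tau.
Proof.
apply: eq_from_tnth => j; rewrite !tnth_mktuple tnth_map /residue.
by rewrite mulnDl addnA.
Qed.

(* A scaled window sees, besides the patterns of one residue, a constant pattern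
   for every letter that occurs only in constant residues. *)
Lemma patterns_residue (A : finType) (x : nat -> A) (D : {set A}) m i k
    (tau : k.-tuple nat) : 0 < m -> window tau ->
  (forall n, residue x m i n \in D) ->
  (forall r, x r \notin D -> forall n, x (r + n * m) = x r) ->
  #|patterns (residue x m i) tau| + #|letters x :\: D|
    <= #|patterns x (map_tuple (muln^~ m) tau)|.
Proof.
move=> m0 wt iD const; have [s etau _] := window_cons wt.
have k0 : 0 < k by rewrite -(size_tuple tau) etau.
pose C := [set nseq_tuple k c | c in letters x :\: D].
have <- : #|C| = #|letters x :\: D|.
  rewrite card_imset // => c c' /(congr1 (fun w => tnth w (Ordinal k0))).
  by rewrite !(tnth_nth c) /= !nth_nseq k0.
have dis : patterns (residue x m i) tau :&: C = set0.
  apply/eqP; apply: contraT => /set0Pn [w /setIP [+ /imsetP [c + wc]]].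
  rewrite {}wc {w} inE => /asboolP [n].
  move=> /(congr1 (fun w => tnth w (Ordinal k0))) + /setDP [_ cD].
  rewrite tnth_mktuple [RHS](tnth_nth c) /= nth_nseq k0 => e.
  by rewrite -e iD in cD.
rewrite -cardsUI dis cards0 addn0.
apply: subset_leq_card; rewrite subUset; apply/andP; split.
  apply/subsetP => w; rewrite inE => /asboolP [n <-].
  by rewrite -pattern_at_scale pattern_in.
apply/subsetP => w /imsetP [c /setDP [/letterP [r rc] cD] ->].
rewrite inE; apply/asboolP; exists r.
apply: eq_from_tnth => j; rewrite tnth_mktuple tnth_map const rc //.
by rewrite (tnth_nth c) /= nth_nseq ltn_ord.
Qed.

Theorem theorem1p2 (A : finType) (alpha : nat -> A) (l : nat)
    (alpha_aperiodic : aperiodic alpha)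
    (card_letters : #|letters alpha| = l)
    (l_ge3 : 3 <= l)
    (alpha_rec : recurrent_letters alpha)
    (alpha_complexity : forall k : nat, 0 < k ->
       max_pattern_complexity alpha k = 2 * k + l - 2) :
  exists m : nat, 1 < m /\
  exists i0 : 'I_m,
    [/\ unique (fun i : 'I_m => aperiodic (residue alpha m i)) i0,
        pattern_sturmian (residue alpha m i0)
      & forall i : 'I_m, i != i0 -> constant_sequence (residue alpha m i)].
Proof.
have /aperiodicE Na := alpha_aperiodic.
have edges2 d : 0 < d -> #|edges alpha d| <= #|letters alpha| + 2.
  by move=> /(card_edges_le alpha); rewrite alpha_complexity // card_letters; lia.
have [a [b [n [aL bL nab n0 kan]]]] := two_letter_core Na edges2 alpha_rec.
have [m [m0 kam kamin]] := pure_period n0 kan.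
have [i0 i0m [Wi const]] := one_wild_residue Na edges2 aL bL nab m0 kam kamin.
pose beta := residue alpha m i0.
have core j : collapse [set a; b] (alpha (i0 + j * m)) = None.
  have [e _] := wild_varies kam Wi.
  by rewrite -e; apply: (@evp_mul _ (fun i => collapse [set a; b] (alpha i)) 0) => // i _.
have inD j : beta j \in [set a; b].
  by have := core j; rewrite /collapse /beta /residue; case: ifP.
(* Such a letter cannot lie in the residue [i0], and all other residues are constant. *)
have letC r : alpha r \notin [set a; b] -> forall j, alpha (r + j * m) = alpha r.
  move=> rD j; rewrite {1}(divn_eq r m) [_ * m + _]addnC -addnA -mulnDl.
  have ri : r %% m != i0.
    apply: contraNneq rD => e; rewrite (divn_eq r m) addnC e; exact: inD.
  rewrite const ?ltn_pmod //.
  by rewrite [in RHS](divn_eq r m) addnC const ?ltn_pmod.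
have DL : [set a; b] \subset letters alpha by rewrite subUset !sub1set aL bL.
have cardD : #|letters alpha :\: [set a; b]| = l - 2.
  by rewrite cardsD (setIidPr DL) cards2 nab card_letters.
have aper i : i < m -> i != i0 -> constant_sequence (residue alpha m i).
  by move=> im ii; exists (alpha i) => j; apply: const.
(* For [m = 1] the wild residue would be all of [alpha], leaving only the letters [a] and [b]. *)
have m1 : 1 < m.
  rewrite ltn_neqAle m0 andbT; apply/eqP => m_1.
  have /set0Pn [c] : letters alpha :\: [set a; b] != set0.
    by rewrite -card_gt0 cardD; lia.
  case/setDP => /letterP [r <-] /negP; apply.
  have := inD r; rewrite /beta /residue -m_1 muln1.
  by move: i0m; rewrite -m_1 ltnS leqn0 => /eqP ->.
exists m; split=> //; exists (Ordinal i0m); split; last first.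
- by move=> i ii; apply: aper => //; apply: contraNneq ii => e; apply/eqP/val_inj.
- have Nb : ~ evp beta by [].
  have bab j : beta j = a \/ beta j = b by apply/set2P.
  split; first exact/aperiodicE.
    have [iN [j bj]] := wild_varies kam Wi.
    have [[ja ea] [jb eb]] := varies_both kam iN bj.
    rewrite -(_ : [set a; b] = letters beta) ?cards2 ?nab //.
    apply/setP => c; apply/set2P/letterP => [[->|->]|[j' <-]]; last exact: bab.
      by exists ja.
    by exists jb.
  move=> [//|k] _; apply/eqP; rewrite eqn_leq.
  have [tau [wt tauk]] := patterns_ge k Nb bab.
  rewrite (leq_trans tauk (card_patterns_le _ wt)) andbT.
  (* Of the at most [2 * k.+1 + l - 2] patterns of the scaled window, [l - 2] are constant patterns
     of letters other than [a] and [b]. *)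
  apply: (max_pattern_complexity_le wt) => tau' wt'.
  have := patterns_residue m0 wt' inD letC.
  have := card_patterns_le alpha (window_scale m0 wt').
  rewrite alpha_complexity // cardD; rewrite -/beta; lia.
- split; first exact/aperiodicE.
  move=> i /aperiodicE Ni; apply: val_inj => /=; apply/eqP; apply: contraT.
  rewrite eq_sym => /(aper _ (ltn_ord i)) [c ec]; case: Ni.
  by exists 0, 1; split=> // j _; rewrite !ec.
Qed.
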